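(* Let $(X,\mathcal{U})$ be a $T_0$ bicomplete quasi-uniform space generated by a family $\mathcal{D}=\{d_\alpha\}_{\alpha\in A}$ of quasi-pseudometrics, let $T\colon X\to X$ be a $\mathcal{D}$-contraction with constants $\{k_\alpha\}_{\alpha\in A}\subseteq[0,1)$, and let $x^*$ be the unique fixed point of $T$ (which exists under these hypotheses). Then for every $x_0\in X$, every $\alpha\in A$ and every $n\ge 0$, $$d_\alpha(T^n x_0,x^* )\le \frac{k_\alpha^n}{1-k_\alpha}\,d_\alpha(x_0,Tx_0),\qquad d_\alpha(x^*,T^n x_0)\le \frac{k_\alpha^n}{1-k_\alpha}\,d_\alpha(Tx_0,x_0).$$
   Context: $X$ is a non-empty set. A quasi-uniformity on $X$ is a filter $\mathcal{U}$ on $X\times X$ such that every $U\in\mathcal{U}$ contains the diagonal $\Delta_X$ and for every $U\in\mathcal{U}$ there is $V\in\mathcal{U}$ with $V\circ V\subseteq U$, where $V\circ V=\{(x,z):\exists y,\ (x,y)\in V,\ (y,z)\in V\}$. The pair $(X,\mathcal{U})$ is a quasi-uniform space. Put $U^{-1}=\{(x,y):(y,x)\in U\}$. The symmetrisation $\mathcal{U}^s$ is the uniformity generated by the entourages $U\cap U^{-1}$, $U\in\mathcal{U}$. $\mathcal{U}$ is $T_0$ if the preorder $\bigcap\mathcal{U}:=\bigcap_{U\in\mathcal{U}}U$ is antisymmetric. $(X,\mathcal{U})$ is bicomplete if the uniform space $(X,\mathcal{U}^s)$ is complete (every net that is Cauchy for $\mathcal{U}^s$ converges in $\mathcal{U}^s$).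 A quasi-pseudometric on $X$ is a function $d\colon X\times X\to[0,\infty)$ with $d(x,x)=0$ and $d(x,z)\le d(x,y)+d(y,z)$. A family $\mathcal{D}$ of quasi-pseudometrics generates the quasi-uniformity having as subbase the sets $\{(x,y):d(x,y)<\varepsilon\}$, $d\in\mathcal{D}$, $\varepsilon>0$. A self-map $T\colon X\to X$ is a $\mathcal{D}$-contraction with constants $\{k_\alpha\}_{\alpha\in A}\subseteq[0,1)$ if for every $\alpha\in A$ and all $x,y\in X$, $d_\alpha(Tx,Ty)\le k_\alpha d_\alpha(x,y)$ and $d_\alpha(Ty,Tx)\le k_\alpha d_\alpha(y,x)$. *)

(* Defs.v *)
From mathcomp Require Import all_boot all_order all_algebra.
From mathcomp Require Import all_classical all_reals.

Set Implicit Arguments.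
Unset Strict Implicit.
Unset Printing Implicit Defensive.

Import Order.TTheory GRing.Theory Num.Theory.

Local Open Scope classical_set_scope.
Local Open Scope ring_scope.
Local Open Scope relation_scope.

Record quasi_uniformity {X : Type} (U : set_system (X * X)) : Prop :=
  QuasiUniformity {
    quasi_uniformity_filter : Filter U;
    quasi_uniformity_diagonal : forall V, U V -> diagonal `<=` V;
    quasi_uniformity_split : forall V, U V -> exists2 W, U W & W \; W `<=` V }.

Definition symmetrisation {X : Type} (U : set_system (X * X)) :
    set_system (X * X) :=
  filter_from U (fun V => V `&` V^-1).

Definition T0_quasi_uniformity {X : Type} (U : set_system (X * X)) : Prop :=
  forall x y : X,
    (\bigcap_(V in U) V) (x, y) -> (\bigcap_(V in U) V) (y, x) -> x = y.

(* Antisymmetry is not required of the index preorder of a net. *)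
Record directed_preorder {I : Type} (le : I -> I -> Prop) : Prop :=
  DirectedPreorder {
    directed_inhabited : inhabited I;
    directed_refl : forall i, le i i;
    directed_trans : forall i j k, le i j -> le j k -> le i k;
    directed_ub : forall i j, exists2 k, le i k & le j k }.

Definition cauchy_net {X I : Type} (ent : set_system (X * X))
    (le : I -> I -> Prop) (u : I -> X) : Prop :=
  forall V, ent V -> exists i, forall j k, le i j -> le i k -> V (u j, u k).

Definition net_cvg_to {X I : Type} (ent : set_system (X * X))
    (le : I -> I -> Prop) (u : I -> X) (x : X) : Prop :=
  forall V, ent V -> exists i, forall j, le i j -> V (x, u j).

Definition net_complete {X : Type} (ent : set_system (X * X)) : Prop :=
  forall (I : Type) (le : I -> I -> Prop) (u : I -> X),
    directed_preorder le -> cauchy_net ent le u ->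
    exists x, net_cvg_to ent le u x.

Definition bicomplete {X : Type} (U : set_system (X * X)) : Prop :=
  net_complete (symmetrisation U).

Record quasi_pseudometric {R : realType} {X : Type} (d : X -> X -> R) : Prop :=
  QuasiPseudometric {
    quasi_pseudometric_ge0 : forall x y, 0 <= d x y;
    quasi_pseudometric_refl : forall x, d x x = 0;
    quasi_pseudometric_triangle : forall x y z, d x z <= d x y + d y z }.

(* The smallest filter containing a family of sets consists of the supersets of
   its finite intersections, so the family is a subbase of it. *)
Definition generated_quasi_uniformity {R : realType} {X A : Type}
    (d : A -> X -> X -> R) : set_system (X * X) :=
  smallest Filter
    [set E | exists a, exists2 e : R, 0 < e & E = [set xy | d a xy.1 xy.2 < e]].

Record family_contraction {R : realType} {X A : Type} (d : A -> X -> X -> R)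
    (k : A -> R) (T : X -> X) : Prop :=
  FamilyContraction {
    contraction_constants : forall a, 0 <= k a < 1;
    contraction_fwd : forall a x y, d a (T x) (T y) <= k a * d a x y;
    contraction_bwd : forall a x y, d a (T y) (T x) <= k a * d a y x }.

(* Main.v *)
Require Import Defs.
From mathcomp Require Import all_boot all_order all_algebra.
From mathcomp Require Import all_classical all_reals.
From mathcomp Require Import normedtype sequences lra.

Set Implicit Arguments.
Unset Strict Implicit.
Unset Printing Implicit Defensive.

Import Order.TTheory GRing.Theory Num.Theory.
Import numFieldNormedType.Exports.

Local Open Scope ring_scope.
Local Open Scope classical_set_scope.

(** For each [d a], the triangle inequality through [T x] and contractivity give
    [d x p <= d x (T x) + k * d x p] at a fixed point [p], hence the bound with
    [n = 0]; iterating the contraction yields the factor [k ^ n].  No passage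
    to the limit is needed.  The same recursion bounds the distances from [x] to
    its orbit, so the orbit is Cauchy, and [T0] turns vanishing of all the
    [d a x y] and [d a y x] into equality of points. *)

Section OneQuasiPseudometric.

Variables (R : realType) (X : Type) (d : X -> X -> R) (c : R) (T : X -> X).
Hypothesis d_qpm : quasi_pseudometric d.
Hypothesis c01 : 0 <= c < 1.
Hypothesis dT : forall x y, d (T x) (T y) <= c * d x y.

(** Reversing the arguments exchanges the two contraction inequalities, so each one-sided result of
    this section also serves for the opposite direction. *)
Lemma quasi_pseudometric_converse : quasi_pseudometric (fun x y => d y x).
Proof.
case: d_qpm => d_ge0 dxx d_tri; split=> // x y z.
by rewrite addrC; exact: d_tri.
Qed.

Lemma contraction_iter n x y :
  d (iter n T x) (iter n T y) <= c ^+ n * d x y.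
Proof.
have /andP[c_ge0 _] := c01.
elim: n => [|n IHn]; first by rewrite mul1r.
by apply: le_trans (dT _ _) _; rewrite exprS -mulrA ler_wpM2l.
Qed.

Lemma contraction_dist_le x y :
  d x y <= d x (T x) + c * d x y -> d x y <= d x (T x) / (1 - c).
Proof.
have /andP[_ c_lt1] := c01.
by rewrite ler_pdivlMr ?subr_gt0 // => dxy; lra.
Qed.

(** The bound [q] solves [q = d x (T x) + c * q], so a triangle step through [T x] carries it from
    [n] to [n.+1]; this replaces summing a geometric series. *)
Lemma contraction_orbit_bounded x n : d x (iter n T x) <= d x (T x) / (1 - c).
Proof.
have /andP[c_ge0 c_lt1] := c01.
case: (d_qpm) => d_ge0 dxx d_tri.
have c1_gt0 : 0 < 1 - c by rewrite subr_gt0.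
elim: n => [|n IHn] /=; first by rewrite dxx divr_ge0 // ltW.
apply: le_trans (d_tri x (T x) _) _.
have := dT x (iter n T x); have := ler_wpM2l c_ge0 IHn.
have : d x (T x) / (1 - c) * (1 - c) = d x (T x) by rewrite divfK ?gt_eqF.
by move: (d x (T x) / (1 - c)) => q; lra.
Qed.

Lemma contraction_orbit_cauchy x n m :
  (n <= m)%N -> d (iter n T x) (iter m T x) <= c ^+ n * (d x (T x) / (1 - c)).
Proof.
have /andP[c_ge0 _] := c01.
move=> /subnKC <-; rewrite iterD; apply: le_trans (contraction_iter _ _ _) _.
by rewrite ler_wpM2l ?exprn_ge0 // contraction_orbit_bounded.
Qed.

Lemma contraction_fixpoint_estimate p x n :
  T p = p -> d (iter n T x) p <= c ^+ n / (1 - c) * d x (T x).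
Proof.
have /andP[c_ge0 _] := c01.
(* Writing [p] as [iter n T p] lets the iterated contraction reduce the estimate to [n = 0]. *)
move=> Tp; have {1}<- : iter n T p = p by elim: n => //= n ->.
apply: le_trans (contraction_iter _ _ _) _.
rewrite -mulrA [_^-1 * _]mulrC ler_wpM2l ?exprn_ge0 // contraction_dist_le //.
apply: le_trans (quasi_pseudometric_triangle d_qpm x (T x) p) _.
by rewrite lerD2l -{1}Tp.
Qed.

Lemma contraction_fixpoint_dist0 p q : T p = p -> T q = q -> d p q = 0.
Proof.
have /andP[_ c_lt1] := c01.
move=> Tp Tq; have := dT p q; rewrite Tp Tq => dpq.
by have := quasi_pseudometric_ge0 d_qpm p q; nra.
Qed.

(** Since [d] may be asymmetric, only pairs with [n <= m] are covered; the other order comes from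
    the converse distance. *)
Lemma contraction_orbit_small x (e : R) : 0 < e ->
  exists i, forall n m, (i <= n <= m)%N -> d (iter n T x) (iter m T x) < e.
Proof.
have /andP[c_ge0 c_lt1] := c01.
move=> e_gt0; set K := d x (T x) / (1 - c).
have K_ge0 : 0 <= K.
  by rewrite divr_ge0 ?(quasi_pseudometric_ge0 d_qpm) // subr_ge0 ltW.
(* [K] may vanish, hence the division by [K + 1]. *)
have e'_gt0 : 0 < e / (K + 1) by rewrite divr_gt0 // ltr_wpDl.
have /cvgrPdist_lt/(_ _ e'_gt0)[i _ ci] : c ^+ n @[n --> \oo] --> (0 : R).
  by apply: cvg_expr; rewrite ger0_norm.
exists i => n m /andP[le_in le_nm].
apply: le_lt_trans (contraction_orbit_cauchy _ le_nm) _.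
have /= := ci n le_in; rewrite sub0r normrN ger0_norm ?exprn_ge0 //.
rewrite ltr_pdivlMr ?ltr_wpDl // => cK; apply: le_lt_trans cK.
by rewrite ler_wpM2l ?exprn_ge0 // lerDl.
Qed.

(** The path from [x] to [T x] through [u i.+1 = T (u i)] has two legs below [e / 2]: the first by
    closeness of [x] to [u i.+1], the second by contracting the distance from [u i] to [x]. Hence
    convergence is assumed in both directions. *)
Lemma contraction_limit_dist0 (u : nat -> X) (x : X) :
  (forall n, u n.+1 = T (u n)) ->
  (forall e : R, 0 < e -> exists i, forall n, (i <= n)%N ->
     d x (u n) < e /\ d (u n) x < e) ->
  d x (T x) = 0.
Proof.
have /andP[c_ge0 c_lt1] := c01.
move=> uS u_cvg; apply/eqP; rewrite eq_le (quasi_pseudometric_ge0 d_qpm) andbT.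
apply/ler_addgt0Pr => e e_gt0; rewrite add0r.
have [i ui] := u_cvg _ (divr_gt0 e_gt0 (ltr0Sn R 1)).
have [xu _] := ui _ (leqnSn i); have [_ ux] := ui _ (leqnn i).
have := quasi_pseudometric_triangle d_qpm x (u i.+1) (T x).
have := dT (u i) x; have := quasi_pseudometric_ge0 d_qpm (u i) x.
by move: xu; rewrite uS => *; nra.
Qed.

End OneQuasiPseudometric.

Section GeneratedQuasiUniformity.

Variables (R : realType) (X A : Type) (d : A -> X -> X -> R).

Lemma generated_quasi_uniformity_ball a (e : R) : 0 < e ->
  generated_quasi_uniformity d [set xy | d a xy.1 xy.2 < e].
Proof. by move=> e_gt0 F [_]; apply; exists a, e. Qed.

(** Minimality of the generated filter acts as an induction principle: a property of entourages that
    defines a filter need only be checked on subbasic balls. *)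
Lemma generated_quasi_uniformity_sub (F : set_system (X * X)) : Filter F ->
  (forall a (e : R), 0 < e -> F [set xy | d a xy.1 xy.2 < e]) ->
  generated_quasi_uniformity d `<=` F.
Proof.
by move=> FF Fd V; apply; split=> // _ [a [e e_gt0 ->]]; exact: Fd.
Qed.

Lemma generated_T0_eq x y :
  T0_quasi_uniformity (generated_quasi_uniformity d) ->
  (forall a, d a x y = 0) -> (forall a, d a y x = 0) -> x = y.
Proof.
have below p q : (forall a, d a p q = 0) ->
    (\bigcap_(V in generated_quasi_uniformity d) V) (p, q).
  move=> dpq V UV.
  (* The sets containing [(p, q)] form a principal filter, which reduces the claim to balls. *)
  suff : globally [set (p, q)] V by exact.
  apply: generated_quasi_uniformity_sub UV => a e e_gt0 _ ->.
  by rewrite /= dpq.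
by move=> dT0 dxy dyx; apply: dT0; exact: below.
Qed.

Lemma cauchy_net_generated (u : nat -> X) :
  (forall a (e : R), 0 < e -> exists i, forall n m, (i <= n)%N -> (i <= m)%N ->
     d a (u n) (u m) < e) ->
  cauchy_net (symmetrisation (generated_quasi_uniformity d))
    (fun i j : nat => (i <= j)%N) u.
Proof.
move=> u_cauchy.
(* [F] collects the relations that hold between any two members of some tail of [u]. *)
pose F : set_system (X * X) := [set V | exists i, forall n m,
  (i <= n)%N -> (i <= m)%N -> V (u n, u m)].
have FF : Filter F.
  split; first by exists 0%N.
    move=> V W [i Vi] [j Wj]; exists (maxn i j) => n m.
    by rewrite !geq_max => /andP[? ?] /andP[? ?]; split; [exact: Vi|exact: Wj].
  by move=> V W VW [i Vi]; exists i => n m ? ?; apply: VW; exact: Vi.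
move=> W [V UV VW].
have [//|i Vi] := @generated_quasi_uniformity_sub F FF _ V UV.
(* Swapping [n] and [m] handles [V^-1] on the same tail. *)
by exists i => n m ? ?; apply: VW; split; exact: Vi.
Qed.

Lemma net_cvg_generated (I : Type) (le : I -> I -> Prop) (u : I -> X) x a e :
  net_cvg_to (symmetrisation (generated_quasi_uniformity d)) le u x ->
  0 < e -> exists i, forall n, le i n -> d a x (u n) < e /\ d a (u n) x < e.
Proof.
move=> u_cvg e_gt0.
(* A ball met with its converse is a symmetrised entourage, so one index controls both
   directions. *)
apply: (u_cvg [set xy | d a xy.1 xy.2 < e /\ d a xy.2 xy.1 < e]).
exists [set xy | d a xy.1 xy.2 < e] => //.
exact: generated_quasi_uniformity_ball.
Qed.

End GeneratedQuasiUniformity.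

Lemma directed_leqn : directed_preorder (fun i j : nat => (i <= j)%N).
Proof.
split=> // [|i j k|i j]; [exact: (inhabits 0%N)|exact: leq_trans|].
by exists (maxn i j); rewrite ?leq_maxl ?leq_maxr.
Qed.

Lemma family_contraction_fixpoint (R : realType) (X A : Type)
    (d : A -> X -> X -> R) (k : A -> R) (T : X -> X) :
  inhabited X ->
  T0_quasi_uniformity (generated_quasi_uniformity d) ->
  bicomplete (generated_quasi_uniformity d) ->
  (forall a, quasi_pseudometric (d a)) ->
  family_contraction d k T ->
  exists x, T x = x.
Proof.
move=> [x0] dT0 d_complete d_qpm [k01 dT dT'].
have d'_qpm a := quasi_pseudometric_converse (d_qpm a).
have dT'' a x y : d a (T y) (T x) <= k a * d a y x by exact: dT'.
pose u n := iter n T x0.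
have u_cauchy : cauchy_net (symmetrisation (generated_quasi_uniformity d))
    (fun i j : nat => (i <= j)%N) u.
  apply: cauchy_net_generated => a e e_gt0.
  have [i di] := contraction_orbit_small (d_qpm a) (k01 a) (dT a) x0 e_gt0.
  have [j dj] := contraction_orbit_small (d'_qpm a) (k01 a) (dT'' a) x0 e_gt0.
  exists (maxn i j) => n m; rewrite !geq_max => /andP[? ?] /andP[? ?].
  by have [?|/ltnW ?] := leqP n m; [apply: di|apply: dj]; apply/andP.
have [x ux] := d_complete _ _ _ directed_leqn u_cauchy.
(* The limit of the orbit is at distance 0 from its image both ways, the second way by the converse
   distance. *)
exists x; apply/esym; apply: (generated_T0_eq dT0) => a.
  apply: (contraction_limit_dist0 (d_qpm a) (k01 a) (dT a) (u := u)) => // e.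
  exact: net_cvg_generated.
apply: (contraction_limit_dist0 (d'_qpm a) (k01 a) (dT'' a) (u := u)) => // e.
move=> /(net_cvg_generated a ux)[i di].
by exists i => n /di[? ?].
Qed.

Theorem corollary4p3 (R : realType) (X A : Type) (U : set_system (X * X))
    (d : A -> X -> X -> R) (k : A -> R) (T : X -> X)
    (X_nonempty : inhabited X)
    (U_qu : quasi_uniformity U)
    (U_T0 : T0_quasi_uniformity U)
    (U_bicomplete : bicomplete U)
    (d_qpm : forall a, quasi_pseudometric (d a))
    (U_gen : U = generated_quasi_uniformity d)
    (T_contr : family_contraction d k T) :
  (exists! x : X, T x = x) /\
  (forall xs : X, T xs = xs ->
    forall (x0 : X) (a : A) (n : nat),
      d a (iter n T x0) xs <= k a ^+ n / (1 - k a) * d a x0 (T x0) /\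
      d a xs (iter n T x0) <= k a ^+ n / (1 - k a) * d a (T x0) x0).
Proof.
subst U; have [k01 dT dT'] := T_contr; split.
  have [x Tx] :=
    family_contraction_fixpoint X_nonempty U_T0 U_bicomplete d_qpm T_contr.
  exists x; split=> // y Ty; apply: (generated_T0_eq U_T0) => a;
    exact: (contraction_fixpoint_dist0 (d_qpm a) (k01 a) (dT a)).
move=> p Tp x a n; split.
  exact: (contraction_fixpoint_estimate (d_qpm a) (k01 a) (dT a)).
(* The second estimate is the first one for the converse distance. *)
apply: (contraction_fixpoint_estimate (quasi_pseudometric_converse (d_qpm a))
  (k01 a) _ _ _ Tp) => y z.
exact: dT'.
Qed.
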